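(* Let $q$ be a prime power and let $\varphi\in\mathbb{F}_q(x)$ be a rational function of degree $3$. Then $\varphi$ induces a permutation of $\mathbb{P}^1(\mathbb{F}_q)$ if and only if $\varphi$ induces a permutation of $\mathbb{P}^1(\mathbb{F}_{q^n})$ for infinitely many positive integers $n$.
   Context: The degree of $f/g$ with $f,g$ coprime is $\max(\deg f,\deg g)$; $\mathbb{P}^1(\mathbb{F}_{q^n})=\mathbb{F}_{q^n}\cup\{\infty\}$. *)

(* Defs.v *)
From mathcomp Require Import all_boot all_order all_fingroup all_algebra.
From mathcomp Require Import all_solvable all_field.
From mathcomp Require Import generic_quotient fraction.

Set Implicit Arguments.
Unset Strict Implicit.
Unset Printing Implicit Defensive.

Import GRing.Theory.
Local Open Scope ring_scope.
Local Open Scope quotient_scope.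

(* [option L] is the projective line over L, with [None] the point at infinity. *)
Notation "''P1' ( L )" := (option L) (at level 8, format "''P1' ( L )") : type_scope.

Section RationalFunctions.

Variable F : fieldType.
Implicit Types (phi : {fraction {poly F}}) (f g : {poly F}).

(* A coprime numerator/denominator pair; lemma [ratfun_numden] shows that it is
   unique up to a common nonzero scalar, and [ratfun_numdenK] that it
   represents phi. *)
Definition ratfun_num phi : {poly F} :=
  \n_(repr phi) %/ gcdp \n_(repr phi) \d_(repr phi).
Definition ratfun_den phi : {poly F} :=
  \d_(repr phi) %/ gcdp \n_(repr phi) \d_(repr phi).

Definition ratfun_deg phi : nat :=
  maxn (size (ratfun_num phi)).-1 (size (ratfun_den phi)).-1.

(* The point [a : b] of the projective line, for (a, b) != (0, 0). *)
Definition P1_point (L : fieldType) (a b : L) : 'P1(L) :=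
  if b == 0 then None else Some (a / b).

(* The map induced by phi = f/g on the projective line of an extension L of F.
   With d = deg phi, and f_h, g_h the degree d homogenizations of f and g,
   [X : Y] is sent to [f_h(X, Y) : g_h(X, Y)]; at infinity = [1 : 0] these
   forms take as values the coefficients of f and g in degree d. *)
Definition ratfun_map (L : fieldType) (i : {rmorphism F -> L}) phi
    (x : 'P1(L)) : 'P1(L) :=
  let f := map_poly i (ratfun_num phi) in
  let g := map_poly i (ratfun_den phi) in
  match x with
  | Some a => P1_point f.[a] g.[a]
  | None => P1_point f`_(ratfun_deg phi) g`_(ratfun_deg phi)
  end.

Definition permutes_P1 (L : fieldType) (i : {rmorphism F -> L}) phi : Prop :=
  bijective (ratfun_map i phi).

Lemma ratfun_den_neq0 phi : ratfun_den phi != 0.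
Proof.
have d0 : \d_(repr phi) != 0 := denom_ratioP (repr phi).
rewrite /ratfun_den dvdp_div_eq0 ?dvdp_gcdr //.
Qed.

Lemma ratfun_coprime phi : coprimep (ratfun_num phi) (ratfun_den phi).
Proof.
have d0 : \d_(repr phi) != 0 := denom_ratioP (repr phi).
by apply: coprimep_div_gcd; rewrite d0 orbT.
Qed.

Lemma ratfun_numdenK phi :
  FracField.tofrac (ratfun_num phi) / FracField.tofrac (ratfun_den phi) = phi.
Proof.
have d0 : \d_(repr phi) != 0 := denom_ratioP (repr phi).
have reprE : phi * FracField.tofrac \d_(repr phi)
             = FracField.tofrac \n_(repr phi).
  move: (reprK phi) d0; move: (repr phi) => r <- d0; apply/eqP.
  change (FracField.mul (\pi_({fraction {poly F}}) r) (FracField.tofrac \d_r) ==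
          FracField.tofrac \n_r).
  rewrite !piE FracField.equivfE /FracField.mulf !numden_Ratio ?mulr1 ?oner_neq0 //.
  by rewrite mulrC.
set h := gcdp \n_(repr phi) \d_(repr phi).
have nE : \n_(repr phi) = ratfun_num phi * h by rewrite divpK ?dvdp_gcdl.
have dE : \d_(repr phi) = ratfun_den phi * h by rewrite divpK ?dvdp_gcdr.
have h0 : h != 0 by apply: contraNneq d0 => h0; rewrite dE h0 mulr0.
apply/(canLR (mulfK _)); first by rewrite tofrac_eq0 ratfun_den_neq0.
have hF0 : FracField.tofrac h != 0 by rewrite tofrac_eq0.
by apply: (mulIf hF0); rewrite -mulrA -!tofracM -dE -nE reprE.
Qed.

Lemma ratfun_numden phi f g : coprimep f g -> g != 0 ->
    phi = FracField.tofrac f / FracField.tofrac g ->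
  exists2 c : F, c != 0 & ratfun_num phi = c *: f /\ ratfun_den phi = c *: g.
Proof.
move=> co_fg g0 phiE; have v0 := ratfun_den_neq0 phi.
have co_uv := ratfun_coprime phi.
have cross : ratfun_num phi * g = f * ratfun_den phi.
  apply/eqP; rewrite -tofrac_eq !tofracM -eqr_div ?tofrac_eq0 //.
  by rewrite ratfun_numdenK phiE.
have gv : ratfun_den phi %= g.
  rewrite coprimep_sym in co_uv; rewrite coprimep_sym in co_fg.
  apply/andP; split.
    by rewrite -(Gauss_dvdpr _ co_uv) cross dvdp_mull.
  by rewrite -(Gauss_dvdpr _ co_fg) -cross dvdp_mull.
case/eqpP: gv => -[c1 c2] /= /andP[c10 c20] cE.
exists (c1^-1 * c2); first by rewrite mulf_neq0 ?invr_eq0.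
have vE : ratfun_den phi = (c1^-1 * c2) *: g.
  by rewrite -scalerA -cE scalerA mulVf ?scale1r.
split=> //; apply: (mulIf g0).
by rewrite cross vE -scalerAr -scalerAl.
Qed.

Lemma ratfun_degE phi f g : coprimep f g -> g != 0 ->
    phi = FracField.tofrac f / FracField.tofrac g ->
  ratfun_deg phi = maxn (size f).-1 (size g).-1.
Proof.
move=> co_fg g0 /(ratfun_numden co_fg g0)[c c0 [uE vE]].
by rewrite /ratfun_deg uE vE !size_scale.
Qed.

Lemma P1_point_scale (L : fieldType) (c a b : L) : c != 0 ->
  P1_point (c * a) (c * b) = P1_point a b.
Proof.
move=> c0; rewrite /P1_point mulf_eq0 (negPf c0) /=; case: eqP => // _.
by rewrite -mulf_div divff // mul1r.
Qed.

Lemma ratfun_mapE (L : fieldType) (i : {rmorphism F -> L}) phi f g (x : 'P1(L)) :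
    coprimep f g -> g != 0 ->
    phi = FracField.tofrac f / FracField.tofrac g ->
  ratfun_map i phi x =
    if x is Some a then P1_point (map_poly i f).[a] (map_poly i g).[a]
    else let d := maxn (size f).-1 (size g).-1 in P1_point (i f`_d) (i g`_d).
Proof.
move=> co_fg g0 phiE; rewrite /ratfun_map (ratfun_degE co_fg g0 phiE).
have [c c0 [-> ->]] := ratfun_numden co_fg g0 phiE.
have ic0 : i c != 0 by rewrite fmorph_eq0.
case: x => [a|] /=; rewrite ?map_polyZ ?hornerZ ?coefZ ?coef_map P1_point_scale //.
Qed.

End RationalFunctions.

Section Extensions.

Variable F : finFieldType.

Definition Fqn_poly (n : nat) : {poly F} := 'X^(#|F| ^ n) - 'X.

Lemma Fqn_exp_gt1 n : (0 < n)%N -> (1 < #|F| ^ n)%N.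
Proof. by move=> n0; rewrite (ltn_exp2l 0) ?finNzRing_gt1. Qed.

Lemma Fqn_poly_neq0 n : (0 < n)%N -> Fqn_poly n != 0.
Proof.
move=> /Fqn_exp_gt1 q1; rewrite -size_poly_gt0 /Fqn_poly.
by rewrite size_polyDl size_polyXn // size_polyN size_polyX.
Qed.

(* The extension of degree n > 0 of F = F_q: the field F_(q^n), as the splitting
   field over F of X^(q^n) - X. *)
Definition Fqn (n : nat) (n_gt0 : (0 < n)%N) : splittingFieldType F :=
  sval (FinSplittingFieldFor (Fqn_poly_neq0 n_gt0)).

Lemma dim_Fqn (n : nat) (n_gt0 : (0 < n)%N) : \dim {:Fqn n_gt0} = n.
Proof.
rewrite /Fqn; case: FinSplittingFieldFor => /= L.
have := Fqn_exp_gt1 n_gt0; rewrite /Fqn_poly; set m := (#|F| ^ n)%N => m_gt1.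
have m_gt0 := ltnW m_gt1; have m1_gt0 : (m.-1 > 0)%N by rewrite -ltnS prednK.
rewrite rmorphB rmorphXn /= map_polyX => -[zs DqL defL].
pose Fm := FinFieldExtType L.
have [p p_pr pcharF] := finPcharP F.
have q0 : #|F|%:R = 0 :> L.
  rewrite (card_pprimeChar pcharF) natrX.
  have pL : p \in [pchar L] by rewrite pchar_lalg.
  rewrite (pcharf0 pL) expr0n; case: eqP => // e0.
  by have := finNzRing_gt1 F; rewrite (card_pprimeChar pcharF) e0.
have m0 : m%:R = 0 :> L by rewrite natrX q0 expr0n gtn_eqF.
have Dq : 'X^m - 'X = ('X^(m.-1) - 1) * ('X - 0) :> {poly L}.
  by rewrite subr0 mulrBl mul1r -exprSr prednK.
have Uzs : uniq zs.
  rewrite -separable_prod_XsubC -(eqp_separable DqL) Dq separable_root andbC.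
  rewrite /root !hornerE subr_eq0 eq_sym expr0n gtn_eqF ?oner_eq0 //=.
  by rewrite cyclotomic.separable_Xn_sub_1 // -subn1 natrB // m0 sub0r oppr_eq0 oner_eq0.
have /finField_galois_generator[/= a _ Da] : (1 <= {:L})%VS by apply: sub1v.
rewrite dimv1 expn1 in Da.
pose Em := fixedSpace (a ^+ n)%g.
have in_zs : zs =i Em.
  move=> z; rewrite -root_prod_XsubC -(eqp_root DqL) (sameP fixedSpaceP eqP).
  rewrite /root !hornerE subr_eq0 /= /m; congr (_ == z).
  elim: (n) => [|i IHi]; first by rewrite gal_id.
  by rewrite expgSr expnSr exprM IHi galM ?Da ?memvf.
have defEm : Em = {:L}%VS.
  apply/eqP; rewrite eqEsubv subvf -defL -[Em]subfield_closed agenvS //.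
  by rewrite subv_add sub1v; apply/span_subvP=> z; rewrite in_zs.
have cardL : #|Fm| = m.
  have /eq_card-> : Fm =i zs by move=> z; rewrite in_zs defEm memvf.
  apply: succn_inj; rewrite (card_uniqP _) //= -(size_prod_XsubC _ id).
  by rewrite -(eqp_size DqL) size_polyDl size_polyXn // size_polyN size_polyX.
have := @card_vspacef F Fm (Vector.class (finvect_type L)).
rewrite card_vspace cardL /m => /eqP.
by rewrite eqn_exp2l ?finNzRing_gt1 // => /eqP.
Qed.

End Extensions.

(* Main.v *)
Require Import Defs.
From mathcomp Require Import all_boot all_order all_algebra all_field.
From mathcomp Require Import fraction.
From mathcomp Require Import all_fingroup ring.

(* Write phi = f/g. The form Phi(x, y) = (f(x) g(y) - f(y) g(x)) / (x - y) is
   symmetric of bidegree (2, 2), and phi is injective on P^1(k) iff Phi has no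
   zero off the diagonal over k. The key point is that injectivity passes from
   k = F_q to its cubic extension. Suppose Phi(x, y) = 0 with x != y in
   F_(q^3). A Moebius map is determined by the images of three points, so the
   map mu sending the conjugates of x to those of y is defined over k, and
   Phi(X, mu X) is a quartic over k divisible by the minimal polynomial m of x.
   If it vanishes identically then every rational point is fixed by mu, so mu is
   the identity and x = y. Otherwise its remaining root r is rational, whence
   mu r = r and Phi(r, r) = 0; then Phi(r, .) has a double root at r (its other
   root is rational), so r is a double root of the quartic, hence a root of m,
   which is absurd. Iterating gives all n = 3^N. The converse is restriction of
   injectivity. *)

Set Implicit Arguments.
Unset Strict Implicit.
Unset Printing Implicit Defensive.

Import GRing.Theory.
Local Open Scope ring_scope.

(* The symmetric forms of bidegree (2, 2) on pairs of points [u : v], [u' : v']. *)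
Definition sym22 (R : comPzRingType) (a b c d e z u v u' v' : R) : R :=
  a * (v * v') ^+ 2 + b * (v * v') * (u * v' + u' * v)
  + c * ((u * v') ^+ 2 + (u' * v) ^+ 2) + d * (u * u' * v * v')
  + e * (u * u') * (u * v' + u' * v) + z * (u * u') ^+ 2.

(** Rationality is a predicate on [K], so that the fixed fields of all powers of [s] live inside one
    field. *)
Definition no_offdiag_zero (K : fieldType) (k : pred K) (Phi : K -> K -> K -> K -> K) :=
  forall u v u' v', u \in k -> v \in k -> u' \in k -> v' \in k ->
    (u, v) != 0 -> (u', v') != 0 -> Phi u v u' v' = 0 -> u * v' = u' * v.

Lemma pair10_neq0 (K : nzRingType) : ((1, 0) : K * K) != 0.
Proof. by rewrite xpair_eqE oner_eq0. Qed.

Lemma pairx1_neq0 (K : nzRingType) (x : K) : ((x, 1) : K * K) != 0.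
Proof. by rewrite xpair_eqE oner_eq0 andbF. Qed.

Lemma quadratic_three_roots (K : fieldType) (a b c x0 x1 x2 : K) :
    x0 != x1 -> x0 != x2 -> x1 != x2 ->
    a * x0 ^+ 2 + b * x0 + c = 0 -> a * x1 ^+ 2 + b * x1 + c = 0 ->
    a * x2 ^+ 2 + b * x2 + c = 0 ->
  [/\ a = 0, b = 0 & c = 0].
Proof.
rewrite -(subr_eq0 x0) -(subr_eq0 x0 x2) -(subr_eq0 x1) => n01 n02 n12 E0 E1 E2.
have a0 : a = 0.
  have /eqP : a * ((x0 - x1) * (x0 - x2) * (x1 - x2)) = 0.
    (* The weights eliminate [b] and [c], leaving [a] times a Vandermonde determinant up to sign. *)
    transitivity ((a * x0 ^+ 2 + b * x0 + c) * (x1 - x2)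
      - (a * x1 ^+ 2 + b * x1 + c) * (x0 - x2)
      + (a * x2 ^+ 2 + b * x2 + c) * (x0 - x1)); first ring.
    by rewrite E0 E1 E2 !mul0r subr0 addr0.
  by rewrite !mulf_eq0 (negPf n01) (negPf n02) (negPf n12) !orbF => /eqP.
have b0 : b = 0.
  have /eqP : b * (x0 - x1) = 0.
    by rewrite -[RHS](subrr 0) -{1}E0 -E1 a0; ring.
  by rewrite mulf_eq0 (negPf n01) orbF => /eqP.
by split=> //; move: E0; rewrite a0 b0 !mul0r !add0r.
Qed.

(** * The cubic step: from the fixed field of [s] to that of its cube *)

Section CubicStep.

Variables (K : fieldType) (s : {rmorphism K -> K}).
Local Notation k := [pred x | s x == x].
Local Notation k3 := [pred x | s (s (s x)) == x].

Variables (a b c d e z : K).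
Hypotheses (sa : s a = a) (sb : s b = b) (sc : s c = c).
Hypotheses (sd : s d = d) (se : s e = e) (sz : s z = z).
Let Phi := sym22 a b c d e z.
Hypothesis Phi_k : no_offdiag_zero k Phi.

Let Phik u v u' v' : s u = u -> s v = v -> s u' = u' -> s v' = v' ->
  (u, v) != 0 -> (u', v') != 0 -> Phi u v u' v' = 0 -> u * v' = u' * v.
Proof. by move=> su sv su' sv'; apply: Phi_k; rewrite inE ?su ?sv ?su' ?sv'. Qed.

Lemma conj_distinct (x : K) : s (s (s x)) = x -> s x != x ->
  [/\ x != s x, x != s (s x) & s x != s (s x)].
Proof.
move=> s3x sx; split.
- by rewrite eq_sym.
- by apply: contraNneq sx => E; rewrite {2}E -{1}s3x {1 2}E s3x -E.
- by rewrite (inj_eq (fmorph_inj s)) eq_sym.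
Qed.

(** The conjugates of [y] are roots too, and three distinct roots kill a quadratic. *)
Lemma irrational_quadratic (A B C y : K) : s A = A -> s B = B -> s C = C ->
    s (s (s y)) = y -> s y != y -> A * y ^+ 2 + B * y + C = 0 ->
  [/\ A = 0, B = 0 & C = 0].
Proof.
move=> sA sB sC s3y sy E0; have [n01 n02 n12] := conj_distinct s3y sy.
have sE x : A * x ^+ 2 + B * x + C = 0 -> A * s x ^+ 2 + B * s x + C = 0.
  by move/(congr1 s); rewrite !(rmorphD, rmorphM, rmorphXn, rmorph0) /= sA sB sC.
exact: quadratic_three_roots n01 n02 n12 E0 (sE _ E0) (sE _ (sE _ E0)).
Qed.

Lemma irrational_linear (p q y : K) : s p = p -> s q = q -> s y != y ->
  p + q * y = 0 -> p = 0 /\ q = 0.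
Proof.
move=> sp sq sy E; have := congr1 s E.
rewrite rmorphD rmorphM rmorph0 /= sp sq -E => /addrI/eqP.
rewrite -subr_eq0 -mulrBr mulf_eq0 subr_eq0 (negPf sy) orbF => /eqP q0.
by move: E; rewrite q0 mul0r addr0.
Qed.

(** If [y] is irrational, the form vanishes identically as a quadratic in [y] with rational
    coefficients; then [u : v] would be both infinity and 0. *)
Lemma no_mixed_zero (u v y : K) : s u = u -> s v = v -> s (s (s y)) = y ->
  (u, v) != 0 -> Phi u v y 1 = 0 -> u = y * v.
Proof.
move=> su sv s3y p0 E.
have [sy|sy] := eqVneq (s y) y.
  by have := Phik su sv sy (rmorph1 s) p0 (pairx1_neq0 y) E; rewrite mulr1.
(* The leading and constant coefficients in [y] are the values at [1 : 0] and [0 : 1]. *)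
have [||||A0 _ C0] := irrational_quadratic (A := Phi u v 1 0)
    (B := b * v ^+ 2 + d * u * v + e * u ^+ 2) (C := Phi u v 0 1) _ _ _ s3y sy.
- by rewrite /Phi /sym22 !(rmorphD, rmorphM, rmorphXn, rmorph0, rmorph1) /=
    sa sb sc sd se sz su sv.
- by rewrite !(rmorphD, rmorphM, rmorphXn) /= sb sd se su sv.
- by rewrite /Phi /sym22 !(rmorphD, rmorphM, rmorphXn, rmorph0, rmorph1) /=
    sa sb sc sd se sz su sv.
- by rewrite -[RHS]E /Phi /sym22; ring.
have := Phik su sv (rmorph1 s) (rmorph0 s) p0 (pair10_neq0 K) A0.
have := Phik su sv (rmorph0 s) (rmorph1 s) p0 (pairx1_neq0 0) C0.
by rewrite mulr0 mul1r mulr1 mul0r => -> <-; rewrite mulr0.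
Qed.

Lemma no_conj_zero (x0 x1 x2 y0 y1 y2 : K) :
    s x0 = x1 -> s x1 = x2 -> s x2 = x0 ->
    s y0 = y1 -> s y1 = y2 -> s y2 = y0 ->
    s x0 != x0 -> s y0 != y0 ->
    x0 != x1 -> x0 != x2 -> x1 != x2 ->
    y0 != y1 -> y0 != y2 -> y1 != y2 ->
  Phi x0 1 y0 1 = 0 -> x0 = y0.
Proof.
move=> sx0 sx1 sx2 sy0 sy1 sy2 sx sy nx01 nx02 nx12 ny01 ny02 ny12 E0.
have sPhi x y : Phi x 1 y 1 = 0 -> Phi (s x) 1 (s y) 1 = 0.
  move/(congr1 s); rewrite /Phi /sym22 !(rmorphD, rmorphM, rmorphXn, rmorph0, rmorph1) /=.
  by rewrite sa sb sc sd se sz.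
have E1 := sPhi _ _ E0; have E2 := sPhi _ _ E1.
rewrite sx0 sy0 in E1 E2; rewrite sx1 sy1 in E2.
(* The minors of the rows (1, x_i, y_i, x_i y_i): the (1, 1)-form through the
   three conjugate points; it is invariant because a 3-cycle is even. *)
pose det3 (p q r : K -> K -> K) : K :=
  p x0 y0 * (q x1 y1 * r x2 y2 - q x2 y2 * r x1 y1)
  - p x1 y1 * (q x0 y0 * r x2 y2 - q x2 y2 * r x0 y0)
  + p x2 y2 * (q x0 y0 * r x1 y1 - q x1 y1 * r x0 y0).
pose c0 := - det3 (fun x _ => x) (fun _ y => y) (fun x y => x * y).
pose c1 := det3 (fun _ _ => 1) (fun _ y => y) (fun x y => x * y).
pose c2 := - det3 (fun _ _ => 1) (fun x _ => x) (fun x y => x * y).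
pose c3 := det3 (fun _ _ => 1) (fun x _ => x) (fun _ y => y).
have [sc0 sc1 sc2 sc3] : [/\ s c0 = c0, s c1 = c1, s c2 = c2 & s c3 = c3].
  by split; rewrite /c0 /c1 /c2 /c3 /det3
    !(rmorphN, rmorphB, rmorphD, rmorphM, rmorph1) /= sx0 sx1 sx2 sy0 sy1 sy2; ring.
have L0 : c0 + c1 * x0 + c2 * y0 + c3 * x0 * y0 = 0.
  by rewrite /c0 /c1 /c2 /c3 /det3; ring.
have L1 : c0 + c1 * x1 + c2 * y1 + c3 * x1 * y1 = 0.
  by rewrite /c0 /c1 /c2 /c3 /det3; ring.
have L2 : c0 + c1 * x2 + c2 * y2 + c3 * x2 * y2 = 0.
  by rewrite /c0 /c1 /c2 /c3 /det3; ring.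
(* This is the coefficient of y in the (1, 1)-form at [x0], hence the denominator of mu there. *)
have D0 : c2 + c3 * x0 != 0.
  have -> : c2 + c3 * x0 = (x2 - x0) * (y1 - y2) * (x1 - x0).
    by rewrite /c2 /c3 /det3; ring.
  by rewrite !mulf_neq0 // subr_eq0 // eq_sym.
move: c0 c1 c2 c3 sc0 sc1 sc2 sc3 L0 L1 L2 D0 => {det3}
  c0 c1 c2 c3 sc0 sc1 sc2 sc3 L0 L1 L2 D0.
have liny p q : s p = p -> s q = q -> p + q * y0 = 0 -> p = 0 /\ q = 0.
  by move=> sp sq; apply: irrational_linear.
(* If the determinant is 0, [c3] times the (1, 1)-form splits into a factor in x and a factor in y,
   and the latter vanishes at the irrational [y0]. *)
have det_neq0 : c0 * c3 - c1 * c2 != 0.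
  apply/eqP => det0.
  have /eqP : (c2 + c3 * x0) * (c1 + c3 * y0) = 0.
    transitivity (c3 * (c0 + c1 * x0 + c2 * y0 + c3 * x0 * y0) 
      - (c0 * c3 - c1 * c2)); first ring.
    by rewrite L0 det0 mulr0 subr0.
  rewrite mulf_eq0 (negPf D0) /= => /eqP /liny[]// c1_0 c3_0.
  have [|||_ c2_0] := liny c0 c2 => //; first by rewrite -[RHS]L0 c1_0 c3_0; ring.
  by case/eqP: D0; rewrite c2_0 c3_0 mul0r addr0.
(* [mu1 : mu2] is the Moebius map sending each x_i to y_i. *)
pose mu1 (u v : K) : K := - (c1 * u + c0 * v); pose mu2 (u v : K) : K := c3 * u + c2 * v.
have mu_neq0 (u v : K) : (u, v) != 0 -> (mu1 u v, mu2 u v) != 0.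
  apply: contraNneq => -[m1 m2].
  have /eqP : (c0 * c3 - c1 * c2) * u = 0.
    transitivity (c2 * mu1 u v + c0 * mu2 u v); first by rewrite /mu1 /mu2; ring.
    by rewrite m1 m2 !mulr0 addr0.
  have /eqP : (c0 * c3 - c1 * c2) * v = 0.
    transitivity (- (c3 * mu1 u v + c1 * mu2 u v)); first by rewrite /mu1 /mu2; ring.
    by rewrite m1 m2 !mulr0 addr0 oppr0.
  by rewrite !mulf_eq0 (negPf det_neq0) /= => /eqP -> /eqP ->.
have smu1 u v : s u = u -> s v = v -> s (mu1 u v) = mu1 u v.
  by move=> su sv; rewrite /mu1 !(rmorphN, rmorphD, rmorphM) /= sc0 sc1 su sv.
have smu2 u v : s u = u -> s v = v -> s (mu2 u v) = mu2 u v.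
  by move=> su sv; rewrite /mu2 !(rmorphN, rmorphD, rmorphM) /= sc3 sc2 su sv.
(* The coefficients of the quartic Phi(p, mu p), by decreasing degree in u. *)
pose g4 := c * c3 ^+ 2 - e * c1 * c3 + z * c1 ^+ 2.
pose g3 := b * c3 ^+ 2 + 2%:R * c * c2 * c3 - d * c1 * c3
  - e * (c1 * (c2 - c1) + c0 * c3) + 2%:R * z * c0 * c1.
pose g2 := a * c3 ^+ 2 + b * (2%:R * c2 * c3 - c1 * c3) + c * (c1 ^+ 2 + c2 ^+ 2)
  - d * (c1 * c2 + c0 * c3) + e * (2%:R * c0 * c1 - c0 * c2) + z * c0 ^+ 2.
pose g1 := 2%:R * a * c2 * c3 + b * (c2 * (c2 - c1) - c0 * c3)
  + 2%:R * c * c0 * c1 - d * c0 * c2 + e * c0 ^+ 2.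
pose g0 := a * c2 ^+ 2 - b * c0 * c2 + c * c0 ^+ 2.
have PhiE u v : Phi u v (mu1 u v) (mu2 u v) =
    g4 * u ^+ 4 + g3 * u ^+ 3 * v + g2 * u ^+ 2 * v ^+ 2 + g1 * u * v ^+ 3 + g0 * v ^+ 4.
  by rewrite /Phi /sym22 /mu1 /mu2 /g4 /g3 /g2 /g1 /g0; ring.
pose e1 := x0 + x1 + x2; pose e2 := x0 * x1 + x0 * x2 + x1 * x2.
pose e3 := x0 * x1 * x2.
have se1 : s e1 = e1 by rewrite /e1 !rmorphD /= sx0 sx1 sx2; ring.
(* The cofactor of the minimal polynomial of x0 in the quartic Phi(p, mu p). *)
pose l1 := g4; pose l0 := g3 + g4 * e1.
have root_g x y : c0 + c1 * x + c2 * y + c3 * x * y = 0 -> Phi x 1 y 1 = 0 ->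
    g4 * x ^+ 4 + g3 * x ^+ 3 + g2 * x ^+ 2 + g1 * x + g0 = 0.
  move=> L E; transitivity (Phi x 1 (mu1 x 1) (mu2 x 1)); first by rewrite PhiE; ring.
  (* The relation [L] says that mu sends x to y. *)
  have -> : mu1 x 1 = y * mu2 x 1.
    by apply/eqP; rewrite eq_sym -subr_eq0 -[X in _ == X]L /mu1 /mu2; apply/eqP; ring.
  by rewrite -[RHS](mulr0 (mu2 x 1 ^+ 2)) -E /Phi /sym22; ring.
(* The remainder of the quartic modulo the minimal polynomial has degree at most 2 and vanishes at
   the three conjugates. *)
have [] : [/\ g2 - l1 * e2 + l0 * e1 = 0, g1 - l0 * e2 + l1 * e3 = 0 & g0 + l0 * e3 = 0].
  apply: (quadratic_three_roots nx01 nx02 nx12).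
  - by rewrite -[RHS](root_g _ _ L0 E0) /l0 /l1 /e1 /e2 /e3; ring.
  - by rewrite -[RHS](root_g _ _ L1 E1) /l0 /l1 /e1 /e2 /e3; ring.
  - by rewrite -[RHS](root_g _ _ L2 E2) /l0 /l1 /e1 /e2 /e3; ring.
move=> g2E g1E g0E.
have g3E : g3 = l0 - l1 * e1 by rewrite /l0 /l1; ring.
have {}g2E : g2 = l1 * e2 - l0 * e1 by rewrite -[LHS]subr0 -[in LHS]g2E; ring.
have {}g1E : g1 = l0 * e2 - l1 * e3 by rewrite -[LHS]subr0 -[in LHS]g1E; ring.
have {}g0E : g0 = - (l0 * e3) by rewrite -[LHS]subr0 -[in LHS]g0E; ring.
have sl1 : s l1 = l1.
  by rewrite /l1 /g4 !(rmorphB, rmorphD, rmorphM, rmorphXn) /= sc se sz sc1 sc3.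
have sg3 : s g3 = g3.
  by rewrite /g3 !(rmorphB, rmorphD, rmorphM, rmorphXn, rmorph1) /=
    sb sc sd se sz sc0 sc1 sc2 sc3.
have sl0 : s l0 = l0 by rewrite /l0 rmorphD rmorphM /= sg3 sl1 se1.
have PhiF u v : Phi u v (mu1 u v) (mu2 u v) =
    (l1 * u + l0 * v) * (u - x0 * v) * (u - x1 * v) * (u - x2 * v).
  by rewrite PhiE g3E g2E g1E g0E -/l1 /e1 /e2 /e3; ring.
(* At a rational root p of the cofactor, p and mu p are rational with Phi(p, mu p) = 0, so they
   coincide. *)
have fixed_pt u v : s u = u -> s v = v -> (u, v) != 0 -> l1 * u + l0 * v = 0 ->
    u * mu2 u v = mu1 u v * v.
  move=> su sv p0 l_uv; apply: Phik; rewrite ?smu1 ?smu2 ?mu_neq0 //.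
  by rewrite PhiF l_uv !mul0r.
have s1 := rmorph1 s; have s0 := rmorph0 s.
have n10 := pair10_neq0 K; have n01 := pairx1_neq0 (0 : K).
have n11 := pairx1_neq0 (1 : K).
(* The cofactor vanishes at [- l0 : l1]; the case of a finite root [rho] comes first. *)
have [l1_0|l1_neq0] := eqVneq l1 0; last first.
  pose rho := - (l0 / l1).
  have srho : s rho = rho by rewrite rmorphN fmorph_div /= sl0 sl1.
  have l_rho : l1 * rho + l0 * 1 = 0.
    by rewrite /rho mulrN mulrC divfK // mulr1 addNr.
  have fix_rho := fixed_pt _ _ srho s1 (pairx1_neq0 rho) l_rho.
  have mu2_neq0 : mu2 rho 1 != 0.
    have := mu_neq0 _ _ (pairx1_neq0 rho); apply: contraNneq => m0.
    by move: fix_rho; rewrite m0 mulr0 mulr1 => <-.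
  (* [A] and [B] are the quadratic and linear coefficients of Phi(rho, Y). *)
  pose A := c + e * rho + z * rho ^+ 2; pose B := b + d * rho + e * rho ^+ 2.
  have sA : s A = A by rewrite /A !(rmorphD, rmorphM, rmorphXn) /= sc se sz srho.
  have sB : s B = B by rewrite /B !(rmorphD, rmorphM, rmorphXn) /= sb sd se srho.
  have Phi_rho : a + b * rho + c * rho ^+ 2 + B * rho + A * rho ^+ 2 = 0.
    have /eqP : mu2 rho 1 ^+ 2 *
        (a + b * rho + c * rho ^+ 2 + B * rho + A * rho ^+ 2) = 0.
      transitivity (Phi rho 1 (rho * mu2 rho 1) (mu2 rho 1)).
        by rewrite /Phi /sym22 /A /B; ring.
      by rewrite fix_rho mulr1 PhiF l_rho !mul0r.
    by rewrite mulf_eq0 expf_eq0 /= (negPf mu2_neq0) => /eqP.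
  (* The second root of Phi(rho, .) is [- (B + A * rho) : A]; being rational it equals [rho], so the
     derivative vanishes there. *)
  have B_rho : B + 2%:R * A * rho = 0.
    have [BA0|BA_neq0] := eqVneq (- (B + A * rho), A) 0.
      by case: BA0 => + A0; rewrite A0 mul0r addr0 mulr0 mul0r addr0;
        move/eqP; rewrite oppr_eq0 => /eqP.
    have /(Phik srho s1 _ _ (pairx1_neq0 rho) BA_neq0) :
        Phi rho 1 (- (B + A * rho)) A = 0.
      rewrite -[RHS](mulr0 (A ^+ 2)) -Phi_rho; rewrite /Phi /sym22 /A /B; ring.
    rewrite rmorphN rmorphD rmorphM /= sA sB srho => /(_ erefl erefl) E.
    by rewrite -(subrr (rho * A)) {2}E; ring.
  have aE : a = A * rho ^+ 2 - b * rho - c * rho ^+ 2.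
    have -> : a = a + b * rho + c * rho ^+ 2 + B * rho + A * rho ^+ 2
      - (B + 2%:R * A * rho) * rho + A * rho ^+ 2 - b * rho - c * rho ^+ 2 by ring.
    by rewrite Phi_rho B_rho; ring.
  have bE : b = - (d * rho + e * rho ^+ 2 + 2%:R * A * rho).
    by rewrite -[LHS]subr0 -[in LHS]B_rho /B; ring.
  have c0E : c0 = - ((c1 + c2) * rho + c3 * rho ^+ 2).
    have E : rho * mu2 rho 1 - mu1 rho 1 = 0 by rewrite fix_rho mulr1 subrr.
    by rewrite -[LHS]subr0 -[in LHS]E /mu1 /mu2; ring.
  (* Phi(rho, .) has a double root at rho, so the quartic has one as well. *)
  have der0 : g1 + 2%:R * g2 * rho + 3%:R * g3 * rho ^+ 2 + 4%:R * g4 * rho ^+ 3 = 0.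
    by rewrite /g1 /g2 /g3 /g4 aE bE c0E /A; ring.
  have l0E : l0 = - (l1 * rho) by rewrite -[LHS]subr0 -[in LHS]l_rho; ring.
  (* Product rule: the cofactor vanishes at [rho], so only its slope [l1] times the minimal
     polynomial survives. *)
  have derE : g1 + 2%:R * g2 * rho + 3%:R * g3 * rho ^+ 2 + 4%:R * g4 * rho ^+ 3
      = l1 * (rho - x0) * (rho - x1) * (rho - x2).
    by rewrite g1E g2E g3E -/l1 l0E /e1 /e2 /e3; ring.
  have rho_x0 : rho != x0 by apply: contraNneq sx => <-; rewrite srho.
  have rho_x1 : rho != x1 by apply: contraNneq nx12 => E; rewrite -sx1 -E srho.
  have rho_x2 : rho != x2 by apply: contraNneq nx02 => E; rewrite -sx2 -E srho.
  move/eqP: derE; rewrite der0 eq_sym !mulf_eq0 !subr_eq0.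
  by rewrite (negPf l1_neq0) (negPf rho_x0) (negPf rho_x1) (negPf rho_x2).
(* From here on mu fixes infinity. *)
have c3_0 : c3 = 0.
  have := fixed_pt _ _ s1 s0 n10; rewrite l1_0 !(mulr0, mul0r, addr0) /mu2.
  by rewrite !(mulr0, mul1r, mulr1, addr0); apply.
(* When the quartic is identically zero, mu fixes 0, 1 and infinity. *)
have [l0_0|l0_neq0] := eqVneq l0 0.
  have l_0 u v : l1 * u + l0 * v = 0 by rewrite l1_0 l0_0 !mul0r addr0.
  have c0_0 : c0 = 0.
    have := fixed_pt _ _ s0 s1 n01 (l_0 _ _); rewrite /mu1 !(mulr0, mul0r, mulr1, add0r).
    by move/esym/eqP; rewrite oppr_eq0 => /eqP.
  have c12 : c2 = - c1.
    have := fixed_pt _ _ s1 s1 n11 (l_0 _ _); rewrite /mu1 /mu2 c3_0 c0_0.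
    by rewrite !(mulr1, mul1r, mul0r, add0r, addr0).
  have /eqP : c1 * (x0 - y0) = 0 by rewrite -[RHS]L0 c12 c3_0 c0_0; ring.
  rewrite mulf_eq0 subr_eq0 => /orP[/eqP c1_0|/eqP//].
  by case/eqP: det_neq0; rewrite c0_0 c1_0 !mul0r subrr.
(* The remaining root is infinity: [z = 0] puts a zero of Phi(infinity, .) there, [e = 0] makes it
   double, and both force [l0 = 0]. *)
have z0 : z = 0.
  have /eqP : z * c1 ^+ 2 = 0 by rewrite -[RHS]l1_0 /l1 /g4 c3_0; ring.
  rewrite mulf_eq0 expf_eq0 /= => /orP[/eqP//|/eqP c1_0].
  by case/eqP: det_neq0; rewrite c3_0 c1_0 mulr0 mul0r subrr.
have e0 : e = 0.
  have [[_ /eqP]|ce_neq0] := eqVneq (c, - e) 0; first by rewrite oppr_eq0 => /eqP.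
  (* With [z = 0], the second zero of Phi(infinity, .) is [c : - e]. *)
  have /(Phik s1 s0 sc _ n10 ce_neq0) : Phi 1 0 c (- e) = 0.
    by rewrite /Phi /sym22 z0; ring.
  by rewrite rmorphN se mulr0 mul1r => /(_ erefl)/eqP; rewrite oppr_eq0 => /eqP.
case/eqP: l0_neq0; rewrite /l0 -/l1 l1_0 /g3 c3_0 z0 e0; ring.
Qed.

(** Infinity is rational, so [no_mixed_zero] covers it; by symmetry only two irrational finite
    points remain, for [no_conj_zero]. *)
Lemma no_offdiag_zero_cubic : no_offdiag_zero k3 Phi.
Proof.
move=> u v u' v' /eqP su /eqP sv /eqP su' /eqP sv' p0 p0' E.
have PhiC x y x' y' : Phi x y x' y' = Phi x' y' x y by rewrite /Phi /sym22; ring.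
have s1 := rmorph1 s; have s0 := rmorph0 s.
have affE x t : Phi x t u' v' = 0 -> v' != 0 -> Phi x t (u' / v') 1 = 0.
  move=> Ex v'_neq0; apply: (mulfI (expf_neq0 2 v'_neq0)).
  by rewrite mulr0 -[RHS]Ex /Phi /sym22; field.
have affE' x t : Phi u v x t = 0 -> v != 0 -> Phi (u / v) 1 x t = 0.
  move=> Ex v_neq0; apply: (mulfI (expf_neq0 2 v_neq0)).
  by rewrite mulr0 -[RHS]Ex /Phi /sym22; field.
have infty x : s (s (s x)) = x -> Phi 1 0 x 1 = 0 -> False.
  move=> sx /(no_mixed_zero s1 s0 sx (pair10_neq0 K))/eqP.
  by rewrite mulr0 oner_eq0.
have s_div x y : s (s (s x)) = x -> s (s (s y)) = y -> s (s (s (x / y))) = x / y.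
  by move=> sx s_y; rewrite !fmorph_div /= sx s_y.
have [v0|v_neq0] := eqVneq v 0; have [v'0|v'_neq0] := eqVneq v' 0.
- by rewrite v0 v'0 !mulr0.
- case: (infty (u' / v')); first exact: s_div.
  have u_neq0 : u != 0 by move: p0; rewrite v0 xpair_eqE eqxx andbT.
  apply: affE v'_neq0; apply: (mulfI (expf_neq0 2 u_neq0)).
  by rewrite mulr0 -[RHS]E v0 /Phi /sym22; ring.
- case: (infty (u / v)); first exact: s_div.
  have u'_neq0 : u' != 0 by move: p0'; rewrite v'0 xpair_eqE eqxx andbT.
  rewrite PhiC; apply: affE' v_neq0; apply: (mulfI (expf_neq0 2 u'_neq0)).
  by rewrite mulr0 -[RHS]E v'0 /Phi /sym22; ring.
suff : u / v = u' / v' by move/eqP; rewrite eqr_div // => /eqP.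
have {}E := affE' _ _ (affE _ _ E v'_neq0) v_neq0.
have := s_div _ _ su sv; have := s_div _ _ su' sv'.
move: (u / v) (u' / v') E => x y E s3y s3x.
have [sx|sx] := eqVneq (s x) x.
  by have := no_mixed_zero sx s1 s3y (pairx1_neq0 x) E; rewrite mulr1.
have [sy|sy] := eqVneq (s y) y.
  by rewrite PhiC in E; have := no_mixed_zero sy s1 s3x (pairx1_neq0 y) E; rewrite mulr1.
have [nx01 nx02 nx12] := conj_distinct s3x sx.
have [ny01 ny02 ny12] := conj_distinct s3y sy.
exact: (no_conj_zero (x1 := s x) (x2 := s (s x)) (y1 := s y) (y2 := s (s y))).
Qed.
End CubicStep.

(** Each induction step replaces [s] by its cube, whose fixed field becomes the new base. *)
Lemma no_offdiag_zero_iter (K : fieldType) (a b c d e z : K) (j : nat)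
    (s : {rmorphism K -> K}) :
  all [pred x | s x == x] [:: a; b; c; d; e; z] ->
  no_offdiag_zero [pred x | s x == x] (sym22 a b c d e z) ->
  no_offdiag_zero [pred x | iter (3 ^ j) s x == x] (sym22 a b c d e z).
Proof.
elim: j s => [//|j IHj] s fix_s Phi_s.
have iterE x : iter (3 ^ j.+1) s x = iter (3 ^ j) (s \o s \o s) x.
  by rewrite expnSr iterM.
have fix3 x : s x == x -> (s \o s \o s) x == x by move=> /eqP sx /=; rewrite !sx.
have step : no_offdiag_zero [pred x | (s \o s \o s) x == x] (sym22 a b c d e z).
  case/and5P: fix_s Phi_s => /eqP sa /eqP sb /eqP sc /eqP sd.
  by case/and3P=> /eqP se /eqP sz _; apply: no_offdiag_zero_cubic.
have := IHj (s \o s \o s) _ step.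
move=> H u v u' v'; rewrite !inE !iterE => *.
apply: H => //; rewrite ?inE //.
by apply: sub_all fix_s => x; apply: fix3.
Qed.

(** * Cubic forms and their Bezoutian *)

Definition cubic_form (R : comPzRingType) (f : nat -> R) (u v : R) : R :=
  f 3%N * u ^+ 3 + f 2%N * u ^+ 2 * v + f 1%N * u * v ^+ 2 + f 0%N * v ^+ 3.

Definition bezoutian (R : comPzRingType) (f g : nat -> R) : R -> R -> R -> R -> R :=
  let m i j := f i * g j - f j * g i in
  sym22 (m 1%N 0%N) (m 2%N 0%N) (m 3%N 0%N) (m 3%N 0%N + m 2%N 1%N)
    (m 3%N 1%N) (m 3%N 2%N).

Lemma bezoutianP (R : comPzRingType) (f g : nat -> R) (u v u' v' : R) :
  cubic_form f u v * cubic_form g u' v' - cubic_form f u' v' * cubic_form g u v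
  = (u * v' - u' * v) * bezoutian f g u v u' v'.
Proof. by rewrite /cubic_form /bezoutian /sym22; ring. Qed.

Lemma P1_point_eq (L : fieldType) (a b a' b' : L) : (a, b) != 0 -> (a', b') != 0 ->
  (P1_point a b == P1_point a' b') = (a * b' == a' * b).
Proof.
rewrite /P1_point !xpair_eqE => ab a'b'.
have [b0|b0] := eqVneq b 0; have [b'0|b'0] := eqVneq b' 0.
- by rewrite b0 b'0 !mulr0 !eqxx.
- rewrite b0 mulr0 mulf_eq0 (negPf b'0) orbF.
  by move: ab; rewrite b0 eqxx andbT => /negPf->.
- rewrite b'0 mulr0 [RHS]eq_sym mulf_eq0 (negPf b0) orbF.
  by move: a'b'; rewrite b'0 eqxx andbT => /negPf->.
- by rewrite (inj_eq Some_inj) eqr_div.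
Qed.

(** * Maps of degree 3 in homogeneous coordinates *)

Section InducedMap.

Variables (F : fieldType) (phi : {fraction {poly F}}).
Hypothesis deg_phi : ratfun_deg phi = 3%N.
Variables (L : fieldType) (i : {rmorphism F -> L}).
Let f := map_poly i (ratfun_num phi).
Let g := map_poly i (ratfun_den phi).
Let f' k := f`_k.
Let g' k := g`_k.

Lemma size_num_den : (size f <= 4)%N /\ (size g <= 4)%N.
Proof.
rewrite !size_map_poly; move: deg_phi; rewrite /ratfun_deg => d.
split; [move: (leq_maxl (size (ratfun_num phi)).-1 (size (ratfun_den phi)).-1)
       | move: (leq_maxr (size (ratfun_num phi)).-1 (size (ratfun_den phi)).-1)].
  by rewrite d; case: size.
by rewrite d; case: size.
Qed.

Lemma cubic_form_horner (p : {poly L}) u v : (size p <= 4)%N -> v != 0 ->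
  cubic_form (fun k => p`_k) u v = v ^+ 3 * p.[u / v].
Proof.
move=> sp v0; rewrite (horner_coef_wide _ sp) !big_ord_recl big_ord0 /=
    /bump /= /cubic_form.
by field.
Qed.

(** At infinity the degree is exactly 3, so one leading coefficient survives; elsewhere coprimality
    excludes a common root. *)
Lemma cubic_forms_neq0 u v : (u, v) != 0 -> (cubic_form f' u v, cubic_form g' u v) != 0.
Proof.
move=> p0; have [sf sg] := size_num_den.
have [v0|v0] := eqVneq v 0.
  have u0 : u != 0 by move: p0; rewrite v0 xpair_eqE eqxx andbT.
  rewrite /cubic_form v0 !(expr0n, mulr0, addr0) /= xpair_eqE.
  rewrite !(mulIr_eq0 _ (mulIf (expf_neq0 3 u0))) /f' /g' !coef_map !fmorph_eq0.
  have lead (p : {poly F}) : (size p).-1 = 3%N -> p`_3 != 0.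
    by move=> sp; rewrite -sp -lead_coefE lead_coef_eq0;
      apply: contra_eq_neq sp => ->; rewrite size_poly0.
  move: deg_phi; rewrite /ratfun_deg /maxn negb_and; case: ifP => _ /lead -> //.
  by rewrite orbT.
have cop : coprimep f g by rewrite coprimep_map ratfun_coprime.
rewrite /f' /g' !cubic_form_horner // xpair_eqE !(mulrI_eq0 _ (mulfI (expf_neq0 3 v0))).
by apply/negP => /andP[f0 /eqP g0]; have := coprimep_root cop f0; rewrite g0 eqxx.
Qed.

Lemma ratfun_map_point u v : (u, v) != 0 ->
  ratfun_map i phi (P1_point u v) = P1_point (cubic_form f' u v) (cubic_form g' u v).
Proof.
move=> p0; have [sf sg] := size_num_den; rewrite /P1_point.
have [v0|v0] := eqVneq v 0.
  have u0 : u != 0 by move: p0; rewrite v0 xpair_eqE eqxx andbT.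
  rewrite /ratfun_map deg_phi -/f -/g /cubic_form v0 !(expr0n, mulr0, addr0) /=.
  by rewrite !(mulrC _ (u ^+ 3)) -/(P1_point _ _) P1_point_scale ?expf_neq0.
rewrite /ratfun_map -/f -/g -/(P1_point _ _) /f' /g' !cubic_form_horner //.
by rewrite P1_point_scale ?expf_neq0.
Qed.

(** By [bezoutianP], two points with equal images either coincide or form a zero of the
    Bezoutian. *)
Lemma ratfun_map_inj : injective (ratfun_map i phi) <->
  no_offdiag_zero predT (bezoutian f' g').
Proof.
split=> [inj u v u' v' _ _ _ _ p0 p0' E | noz x y].
  apply/eqP; rewrite -P1_point_eq //; apply/eqP/inj/eqP.
  rewrite !ratfun_map_point // P1_point_eq ?cubic_forms_neq0 //.
  by rewrite -subr_eq0 bezoutianP E mulr0.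
have repr (p : option L) : exists2 q : L * L, q != 0 & p = P1_point q.1 q.2.
  case: p => [t|]; last by exists (1, 0); rewrite ?pair10_neq0 /P1_point ?eqxx.
  by exists (t, 1); rewrite ?pairx1_neq0 // /P1_point oner_eq0 divr1.
have [[u v] p0 ->] := repr x; have [[u' v'] p0' ->] := repr y.
rewrite !ratfun_map_point //= => /eqP; rewrite P1_point_eq ?cubic_forms_neq0 //.
rewrite -subr_eq0 bezoutianP mulf_eq0 subr_eq0 => E.
apply/eqP; rewrite P1_point_eq //; case/orP: E => // /eqP E.
by apply/eqP/noz.
Qed.

End InducedMap.

(** * Frobenius and change of base field *)

Lemma rmorph_bezoutian (R S : comPzRingType) (h : {rmorphism R -> S})
    (f g : nat -> R) (u v u' v' : R) :
  h (bezoutian f g u v u' v')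
  = bezoutian (h \o f) (h \o g) (h u) (h v) (h u') (h v').
Proof. by rewrite /bezoutian /sym22 /=; ring. Qed.

Lemma finField_frobenius (F : finFieldType) (L : splittingFieldType F) :
  {s : {rmorphism L -> L} | [/\ forall c : F, s c%:A = c%:A,
     forall x, s x = x -> exists c : F, x = c%:A &
     forall x, iter (\dim {:L}) s x = x]}.
Proof.
have /finField_galois_generator[/= a gen_a] : (1 <= {:L})%VS by apply: sub1v.
rewrite dimv1 expn1 => a_frob.
have aE x : a x = x ^+ #|F| by rewrite a_frob ?memvf.
exists (gal_repr a); split=> [c|x ax|x].
- by rewrite [LHS]aE -(rmorphXn (in_alg L)) expf_card.
(* A fixed point is a root of X^q - X, the product of the X - c over c in [F]. *)
- have /(congr1 (fun p => (map_poly (in_alg L) p).[x])) := finField_genPoly F.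
  rewrite rmorphB rmorphXn /= map_polyX rmorph_prod horner_prod !hornerE -aE ax subrr.
  move/esym/eqP; rewrite prodf_seq_eq0 => /hasP[c _ /=].
  by rewrite rmorphB /= map_polyX map_polyC !hornerE subr_eq0 => /eqP xc; exists c.
have iterE m : iter m a x = (a ^+ m)%g x.
  by elim: m => [|m IHm]; rewrite ?gal_id // expgSr galM ?memvf //= IHm.
rewrite iterE; have -> : \dim {:L} = #[a]%g.
  have := galois_dim (finField_galois (sub1v {:L}%AS)).
  by rewrite dimv1 divn1 (eqP gen_a).
by rewrite expg_order gal_id.
Qed.

Lemma ratfun_map_ext (F L : fieldType) (i : {rmorphism F -> L})
    (phi : {fraction {poly F}}) (x : option F) :
  omap i (ratfun_map idfun phi x) = ratfun_map i phi (omap i x).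
Proof.
have pointE u v : omap i (P1_point u v) = P1_point (i u) (i v).
  by rewrite /P1_point fmorph_eq0; case: eqP => //= _; rewrite fmorph_div.
have hornerE' p t : i (map_poly idfun p).[t] = (map_poly i p).[i t].
  by rewrite map_poly_id // horner_map.
by case: x => [t|] /=; rewrite pointE ?hornerE' // !coef_map.
Qed.

Theorem theorem8p1 (F : finFieldType) (phi : {fraction {poly F}})
    (deg_phi : ratfun_deg phi = 3%N) :
  permutes_P1 (idfun : {rmorphism F -> F}) phi <->
  (forall N : nat, exists (n : nat) (n_gt0 : (0 < n)%N),
     (N < n)%N /\ permutes_P1 (in_alg (Fqn F n_gt0)) phi).
Proof.
split=> [bij N | /(_ 0%N)[n [n_gt0 [_ bij]]]]; last first.
  (* Injectivity restricts to the points over [F], and an injective self-map of a finite set is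
     bijective. *)
  apply/injF_bij => x y E; apply: (inj_omap (fmorph_inj (in_alg (Fqn F n_gt0)))).
  by apply: (bij_inj bij); rewrite -!ratfun_map_ext E.
exists (3 ^ N)%N; have n_gt0 : (0 < 3 ^ N)%N by rewrite expn_gt0.
exists n_gt0; split; first exact: ltn_expl.
set L := Fqn F n_gt0; set i := in_alg L.
suff inj : injective (ratfun_map i phi).
  exact: (@injF_bij (option (finvect_type L)) _ inj).
have [s [s_alg fix_s iter_s]] := finField_frobenius L.
rewrite dim_Fqn in iter_s.
have /(ratfun_map_inj deg_phi) noz := bij_inj bij.
apply/(ratfun_map_inj deg_phi).
have sm j k : s ((map_poly i (ratfun_num phi))`_j * (map_poly i (ratfun_den phi))`_k) =
    (map_poly i (ratfun_num phi))`_j * (map_poly i (ratfun_den phi))`_k.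
  by rewrite !coef_map rmorphM /= !s_alg.
(* Frobenius iterated 3^N times, the degree of [L], is the identity, so every point of [L] is
   covered. *)
suff : no_offdiag_zero [pred x | iter (3 ^ N) s x == x]
    (bezoutian (fun k => (map_poly i (ratfun_num phi))`_k)
      (fun k => (map_poly i (ratfun_den phi))`_k)).
  by move=> H u v u' v' _ _ _ _; apply: H; rewrite inE iter_s.
apply: no_offdiag_zero_iter; first by rewrite /= !(rmorphD, rmorphN) !sm !eqxx.
(* Points fixed by Frobenius come from [F], where the hypothesis applies. *)
move=> u v u' v' /eqP/fix_s[u0 ->] /eqP/fix_s[v0 ->].
move=> /eqP/fix_s[u0' ->] /eqP/fix_s[v0' ->].
have pair0 (p q : F) : ((p%:A, q%:A) != 0 :> L * L) = ((p, q) != 0).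
  by rewrite !xpair_eqE !(fmorph_eq0 i).
rewrite !pair0 => p0 p0' E; rewrite -!(rmorphM i); congr (_%:A).
apply: noz => //; apply: (fmorph_inj i); rewrite rmorph_bezoutian rmorph0 -[RHS]E.
by rewrite /bezoutian /= !coef_map.
Qed.
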